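(* Let $\mathbf q=\{q_i\mid i\in\mathbb Z\}$ be a family of indeterminates over $\mathbb Z$ and let $\{x_{i,1}\mid i\in\mathbb Z\}$ be a family of indeterminates over $\mathbb Z[\mathbf q]$. Define by induction a family $\{x_{i,n}\mid i\in\mathbb Z,\ n\ge 1\}\subset \mathbb Q(\mathbf q)(x_{i,1}\mid i\in\mathbb Z)$ by $$x_{i,n}x_{i+1,n}=x_{i,n+1}x_{i+1,n-1}+\prod_{k=1}^n q_{i+k}\qquad (i\in\mathbb Z,\ n\ge 1),$$ with the convention $x_{i,0}=1$ for all $i\in\mathbb Z$. Then for any $n\ge 1$ and any $i\in\mathbb Z$, $$x_{i,n}=\det\begin{bmatrix} x_{i+n-1,1} & 1 & & & (0)\\ q_{i+n-1} & \ddots & \ddots & & \\ & \ddots & \ddots & \ddots & \\ & & \ddots & \ddots & 1\\ (0) & & & q_{i+1} & x_{i,1}\end{bmatrix},$$ the determinant of the $n\times n$ tridiagonal matrix with diagonal entries $x_{i+n-1,1},x_{i+n-2,1},\dots,x_{i,1}$ (top to bottom), all superdiagonal entries equal to $1$, and subdiagonal entries $q_{i+n-1},q_{i+n-2},\dots,q_{i+1}$ (top to bottom). In particular, $x_{i,n}$ is a polynomial in $\mathbb Z[q_{i+1},\dots,q_{i+n-1},x_{i,1},\dots,x_{i+n-1,1}]$.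
   Context: All objects are defined in the claim. The recursion determines $x_{i,n+1}$ from $x_{i,n}$, $x_{i+1,n}$ and $x_{i+1,n-1}$ by division in the field of rational functions. *)

(* Defs.v *)
From HB Require Import structures.
From mathcomp Require Import all_boot all_order all_algebra.
From mathcomp Require Import finmap.
From mathcomp Require Import(coercions,canonicals) mpoly.
From mathcomp Require Import monalg.

Set Implicit Arguments.
Unset Strict Implicit.
Unset Printing Implicit Defensive.

Import GRing.Theory.
Local Open Scope ring_scope.

(* [{malg R[{cmonom I}]}] is the polynomial ring R[X_i | i in I] in an
   arbitrary, possibly infinite, set of indeterminates.  Its integral domain
   structure, needed to take fractions, is obtained by sending a pair of
   polynomials to a polynomial ring in finitely many indeterminates. *)
Section PolyInfIdomain.
Context (I : choiceType) (R : idomainType).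
Implicit Types (p q : {malg R[{cmonom I}]}) (m : {cmonom I}) (s : seq I).

Let restr_mnm s m : mpoly.multinom (size s) :=
  mpoly.Multinom [tuple m (tnth (in_tuple s) i) | i < size s].

Let restr_mnmE s m i : restr_mnm s m i = m (tnth (in_tuple s) i).
Proof. by rewrite mpoly.multinomE tnth_mktuple. Qed.

Let restr_mon s m : mpoly.mpoly (size s) R := mpoly.mpolyX R (restr_mnm s m).

Let restr_mon_mmorph s : mmorphism (restr_mon s).
Proof.
split=> [m1 m2|].
  rewrite /restr_mon -mpoly.mpolyXD; congr mpoly.mpolyX.
  by apply/mpoly.mnmP=> i; rewrite mpoly.mnmDE !restr_mnmE cmM.
rewrite /restr_mon -mpoly.mpolyX0; congr mpoly.mpolyX.
by apply/mpoly.mnmP=> i; rewrite mpoly.mnm0E !restr_mnmE cm1.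
Qed.

HB.instance Definition _ s := isMultiplicative.Build _ _ (restr_mon s)
  (restr_mon_mmorph s).

Let restr s := mmap (@mpoly.mpolyC (size s) R) (restr_mon s).

Let restrM s : {morph restr s : p q / p * q}.
Proof. exact: rmorphM. Qed.

Let restr1 s : restr s 1 = 1.
Proof. exact: rmorph1. Qed.

Let restr0 s : restr s 0 = 0.
Proof. exact: raddf0. Qed.

Let supp_in s m := all (fun i => i \in s) (finsupp m).

Let restr_mnm_inj s m1 m2 : supp_in s m1 -> supp_in s m2 ->
  restr_mnm s m1 = restr_mnm s m2 -> m1 = m2.
Proof.
move=> /allP s1 /allP s2 e; apply/eqP/cmP=> i.
have [is_|] := boolP (i \in s).
  have lt_is : (index i s < size s)%N by rewrite index_mem.
  have := congr1 (fun f : mpoly.multinom _ => f (Ordinal lt_is)) e.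
  by rewrite !restr_mnmE !(tnth_nth i) /= nth_index.
move=> nis; have z m : {subset finsupp m <= s} -> m i = 0%N.
  by move=> sm; apply/eqP; rewrite cmE_eq0; apply: contra nis => /sm.
by rewrite !z.
Qed.

Let restr_coeff s p m :
  (forall m', m' \in msupp p -> supp_in s m') -> supp_in s m ->
  mpoly.mcoeff (restr_mnm s m) (restr s p) = p@_m.
Proof.
move=> sp sm; rewrite /restr /mmap raddf_sum /=.
under eq_big_seq => m' m'p.
  rewrite mpoly.mcoeffCM mpoly.mcoeffX.
  have -> : (restr_mnm s m' == restr_mnm s m) = (m' == m).
    apply/eqP/eqP=> [|->//]; exact: restr_mnm_inj (sp _ m'p) sm.
  over.
have [mp|nmp] := boolP (m \in msupp p).
  rewrite (bigD1_seq m) //= ?fset_uniq // eqxx mulr1 big1 ?addr0 //.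
  by move=> m' /negPf->; rewrite mulr0.
rewrite (mcoeff_outdom nmp) big1_seq // => m' /andP[_ m'p].
have [e|_] := eqVneq m' m; last by rewrite mulr0.
by rewrite -e m'p in nmp.
Qed.

Let vars p : seq I := flatten [seq (finsupp m : seq I) | m <- msupp p].

Let supp_vars s p : {subset vars p <= s} ->
  forall m, m \in msupp p -> supp_in s m.
Proof.
by move=> sub m mp; apply/allP=> i im; apply/sub/flatten_mapP; exists m.
Qed.

Let restr_eq0 s p : {subset vars p <= s} -> restr s p = 0 -> p = 0.
Proof.
move=> /supp_vars sp r0; apply/malgP=> m; rewrite mcoeff0.
have [mp|/mcoeff_outdom//] := boolP (m \in msupp p).
by rewrite -(restr_coeff sp (sp _ mp)) r0 mpoly.mcoeff0.
Qed.

Let malg_idomainAxiom p q : p * q = 0 -> (p == 0) || (q == 0).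
Proof.
move=> pq0; pose s := vars p ++ vars q.
have := congr1 (restr s) pq0; rewrite restrM restr0 => /eqP.
rewrite mulf_eq0 => /orP[] /eqP/restr_eq0 ->; rewrite ?eqxx ?orbT //.
  by move=> i ip; rewrite mem_cat ip.
by move=> i iq; rewrite mem_cat iq orbT.
Qed.

Let malg_unit : pred {malg R[{cmonom I}]} :=
  fun p => (p == (p@_mone)%:MP) && (p@_mone \in GRing.unit).

Let malg_inv p := if p \in malg_unit then ((p@_mone)^-1)%:MP else p.

Let malg_mulVp : {in malg_unit, left_inverse 1 malg_inv *%R}.
Proof.
move=> p Up; rewrite /malg_inv Up; case/andP: Up => /eqP {3}-> Up.
by rewrite -mpolyCM mulVr.
Qed.

Let malg_intro_unit p q : q * p = 1 -> p \in malg_unit.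
Proof.
move=> qp1; apply/andP; split; last first.
  apply/unitrP; exists q@_mone.
  by rewrite mulrC -rmorphM mulrC qp1 rmorph1.
have := congr1 (restr (vars p)) qp1; rewrite restrM restr1.
move=> /mpoly.mpoly_intro_unit /andP[/eqP rp _].
have sp := @supp_vars (vars p) p (fun _ h => h).
apply/eqP/malgP=> m; rewrite mcoeffC.
have [->|m1] := eqVneq mone m; first by rewrite mulr1n.
have [mp|/mcoeff_outdom//] := boolP (m \in msupp p).
rewrite -(restr_coeff sp (sp _ mp)) rp mpoly.mcoeffC.
case: eqP => [e|]; last by rewrite mulr0.
case/eqP: m1; apply: (@restr_mnm_inj (vars p)); last 1 first.
- by rewrite e; apply/mpoly.mnmP=> i; rewrite mpoly.mnm0E restr_mnmE cm1.
- by rewrite /supp_in mdom1.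
- exact: sp.
Qed.

Let malg_inv_out : {in [predC malg_unit], malg_inv =1 id}.
Proof. by rewrite /malg_inv => p /negbTE /= ->. Qed.

HB.instance Definition _ := GRing.ComRing_hasMulInverse.Build
  (malg {cmonom I} R) malg_mulVp malg_intro_unit malg_inv_out.

HB.instance Definition _ := GRing.ComUnitRing_isIntegral.Build
  (malg {cmonom I} R) malg_idomainAxiom.

End PolyInfIdomain.

(* K(X_i | i in I) *)
Definition ratfun (I : choiceType) (K : fieldType) : fieldType :=
  {fraction {malg K[{cmonom I}]}}.

Definition ratfunC (I : choiceType) (K : fieldType) (c : K) : ratfun I K :=
  FracField.tofrac (c%:MP : {malg K[{cmonom I}]}).

Definition ratfunX (I : choiceType) (K : fieldType) (i : I) : ratfun I K :=
  FracField.tofrac (<< ucm i >> : {malg K[{cmonom I}]}).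

(* Q(q) and Q(q)(x_{i,1} | i in Z) *)
Definition Qq : fieldType := ratfun int rat.
Definition Qqx : fieldType := ratfun int Qq.

Definition qind (i : int) : Qqx := ratfunC int (ratfunX rat i).
Definition xind (i : int) : Qqx := ratfunX Qq i.

Section Family.
Context (F : fieldType) (q x1 : int -> F).

(* The family x_{i,n} with x_{i,0} = 1 and x_{i,1} = x1 i, defined by solving
     x_{i,n} x_{i+1,n} = x_{i,n+1} x_{i+1,n-1} + \prod_{k=1}^n q_{i+k}
   for x_{i,n+1}.  Since a / 0 = 0 here, this identity is not built in: it
   holds once the divisors x_{i+1,n-1} are known to be nonzero. *)
Fixpoint xfam (i : int) (n : nat) {struct n} : F :=
  if n isn't m.+1 then 1 else
  if m isn't m'.+1 then x1 i else
  (xfam i m * xfam (i + 1) m - \prod_(1 <= k < m.+1) q (i + k%:Z))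
    / xfam (i + 1) m'.

(* Rows and columns are numbered from 0. *)
Definition tridiag (i : int) (n : nat) : 'M[F]_n :=
  \matrix_(r < n, c < n)
    if c == r :> nat then x1 (i + n%:Z - 1 - r%:Z)
    else if c == r.+1 :> nat then 1
    else if r == c.+1 :> nat then q (i + n%:Z - r%:Z)
    else 0.

(* q_{i+1}, ..., q_{i+n-1}, x_{i,1}, ..., x_{i+n-1,1} *)
Definition Zqx_gens (i : int) (n : nat) (j : 'I_(n.-1 + n)) : F :=
  match split j with
  | inl a => q (i + 1 + (a : nat)%:Z)
  | inr b => x1 (i + (b : nat)%:Z)
  end.

(* f is the value at these elements of a polynomial with integer coefficients,
   i.e. f lies in the subring Z[q_{i+1}, ..., x_{i+n-1,1}]. *)
Definition in_Zqx (i : int) (n : nat) (f : F) : Prop :=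
  exists P : mpoly.mpoly (n.-1 + n) int,
    f = mpoly.mmap (intr : int -> F) (@Zqx_gens i n) P.

End Family.

(* Main.v *)
Require Import Defs.
From HB Require Import structures.
From mathcomp Require Import all_boot all_order all_algebra.
From mathcomp Require Import zify ring.
From mathcomp Require Import(coercions,canonicals) mpoly.
From mathcomp Require Import monalg.

(** The determinant of the tridiagonal matrix is a continuant: expanding along
    the first row gives the three-term recursion
      D_{i,n+2} = x_{i+n+1} D_{i,n+1} - q_{i+n+1} D_{i,n},
    so it is enough to identify x_{i,n} with the sequence D_{i,n} defined by that
    recursion with D_{i,0} = 1 and D_{i,1} = x_{i,1} ([det_tridiag]).

    The family x_{i,n} is characterised by an exchange relation together with its
    values for n = 0 and n = 1, provided that one never divides by zero.  Hence
    two facts carry the proof.  First, continuants satisfy the exchange relation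
    over any commutative ring ([continuant_exchange]): the quantity
      W_n = D_{i,n} D_{i+1,n} - D_{i,n+1} D_{i+1,n-1}
    is a 2 x 2 determinant built from two solutions of the same three-term
    recursion, so going from n to n+1 multiplies it by q_{i+n+1} (a discrete
    Wronskian argument).  Second, no D_{i,n} vanishes in the field of rational
    functions ([continuant_ratfun_neq0]): specialising every x_{j,1} to a single
    variable X turns D_{i,n} into a polynomial in X of degree exactly n.

    That x_{i,n} is an integer polynomial in the listed indeterminates is then
    read off the recursion, whose coefficients are 1, q_j and x_{j,1}
    ([in_Zqx_continuant]). *)

Import GRing.Theory.
Local Open Scope ring_scope.

(** The branch at n = 1 is separate so that the recursion starts without a
    value at n = -1. *)
Fixpoint continuant (R : comNzRingType) (q x : int -> R) (i : int) (n : nat)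
    {struct n} : R :=
  match n with
  | 0 => 1
  | m.+1 => match m with
    | 0 => x i
    | m'.+1 => x (i + m%:Z) * continuant R q x i m
               - q (i + m%:Z) * continuant R q x i m'
    end
  end.
Arguments continuant {R} q x i n.

Lemma continuantSS (R : comNzRingType) (q x : int -> R) i n :
  continuant q x i n.+2 = x (i + n.+1%:Z) * continuant q x i n.+1
                          - q (i + n.+1%:Z) * continuant q x i n.
Proof. by []. Qed.

Lemma nat_ind2 (P : nat -> Prop) :
  P 0%N -> P 1%N -> (forall n, P n -> P n.+1 -> P n.+2) -> forall n, P n.
Proof.
move=> P0 P1 PS n; suff [] : P n /\ P n.+1 by [].
by elim: n => [//|n [Pn PSn]]; split=> //; apply: PS.
Qed.

Lemma eq_continuant (R : comNzRingType) (q q' x x' : int -> R) i n :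
  q =1 q' -> x =1 x' -> continuant q x i n = continuant q' x' i n.
Proof.
move=> qE xE; elim/nat_ind2: n => [//|/=|n IH0 IH1]; first by rewrite xE.
by rewrite !continuantSS IH0 IH1 qE xE.
Qed.

(** Continuants are polynomial expressions in their entries; this transports
    them to a specialisation where they are easy to see nonzero. *)
Lemma rmorph_continuant (R S : comNzRingType) (f : {rmorphism R -> S})
    (q x : int -> R) i n :
  f (continuant q x i n) = continuant (f \o q) (f \o x) i n.
Proof.
elim/nat_ind2: n => [|//|n IH0 IH1]; first by rewrite /= rmorph1.
by rewrite !continuantSS rmorphB !rmorphM IH0 IH1.
Qed.

(** The first row has only the entries x_{i+n+1} and 1.  Deleting row and column
    0 gives the matrix of size n+1 for the same i, since rows are numbered from
    the largest index down.  In the minor of the entry 1, the first column has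
    the single nonzero entry q_{i+n+1}, and its own minor is the matrix of
    size n. *)
Lemma det_tridiagSS (F : fieldType) (q x : int -> F) i n :
  \det (tridiag q x i n.+2) = x (i + n.+1%:Z) * \det (tridiag q x i n.+1)
                              - q (i + n.+1%:Z) * \det (tridiag q x i n).
Proof.
rewrite (expand_det_row _ ord0) 2!big_ord_recl big1 ?addr0; last first.
  by move=> j _; rewrite !mxE /= mul0r.
congr (_ + _).
  rewrite !mxE /=; congr (x _ * _); first by lia.
  rewrite /cofactor /= addn0 expr0 mul1r; congr (\det _).
  apply/matrixP=> r c; rewrite !mxE /= /bump /= !add1n !eqSS.
  by congr (if _ then x _ else if _ then _ else if _ then q _ else _); lia.
rewrite !mxE /= mul1r /cofactor /= expr1 mulN1r; congr (- _).
(* The minor left here has rows 1, 2, ... and columns 0, 2, 3, ... *)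
rewrite (expand_det_col _ ord0) big_ord_recl big1 ?addr0; last first.
  by move=> r _; rewrite !mxE /= mul0r.
rewrite !mxE /=; congr (q _ * _); first by rewrite /bump /=; lia.
rewrite /cofactor /= addn0 expr0 mul1r; congr (\det _).
apply/matrixP=> r c; rewrite !mxE /= /bump /= !add1n !eqSS.
by congr (if _ then x _ else if _ then _ else if _ then q _ else _); lia.
Qed.

Lemma det_tridiag (F : fieldType) (q x : int -> F) i n :
  \det (tridiag q x i n) = continuant q x i n.
Proof.
elim/nat_ind2: n => [||n IH0 IH1]; first by rewrite det_mx00.
  by rewrite det_mx11 mxE /=; congr x; lia.
by rewrite det_tridiagSS IH0 IH1.
Qed.

(** Both sequences n |-> D_{i,n+1} and n |-> D_{i+1,n} solve the recursion
    u_{n+1} = x_{i+n+1} u_n - q_{i+n+1} u_{n-1}, because D_{i+1,n} ends at the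
    same index as D_{i,n+1}.  Their Casorati determinant is therefore multiplied
    by q_{i+n+1} at each step, which builds up the product. *)
Lemma continuant_exchange (R : comNzRingType) (q x : int -> R) i n :
  continuant q x i n.+1 * continuant q x (i + 1) n.+1 =
    continuant q x i n.+2 * continuant q x (i + 1) n
    + \prod_(1 <= k < n.+2) q (i + k%:Z).
Proof.
elim: n => [|n IH]; first by rewrite big_nat1 /=; ring.
have iE : i + 1 + n.+1%:Z = i + n.+2%:Z by lia.
rewrite big_nat_recr //.
move: IH; rewrite (continuantSS R q x i n.+1) (continuantSS R q x (i + 1)) iE.
move: (continuant q x i n.+1) (continuant q x i n.+2) => a b.
move: (continuant q x (i + 1) n.+1) (continuant q x (i + 1) n) => c d.
move: (\prod_(1 <= k < n.+2) _) => P IH.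
have -> : P = a * c - b * d by rewrite IH addrC addKr.
by rewrite /=; ring.
Qed.

(** When the divisors are nonzero, the exchange relation determines the family
    from its first two layers. *)
Lemma xfam_continuant (F : fieldType) (q x : int -> F) :
  (forall i n, continuant q x i n != 0) ->
  forall n i, xfam q x i n = continuant q x i n.
Proof.
move=> D0; elim/nat_ind2=> [//|//|n IH0 IH1] i.
rewrite [LHS]/= -/(xfam q x i n.+1) -/(xfam q x (i + 1) n.+1).
by rewrite !IH0 !IH1 continuant_exchange addrK mulfK.
Qed.

(** With constant q_j and all x_j equal to 'X, the first term of the recursion
    raises the degree by one and the second has smaller degree. *)
Lemma size_continuant (R : comNzRingType) (q : int -> R) i n :
  size (continuant (fun j => (q j)%:P) (fun=> 'X) i n) = n.+1.
Proof.
elim/nat_ind2: n => [|/=|n IH0 IH1]; rewrite ?size_poly1 ?size_polyX //.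
rewrite continuantSS mulrC size_polyDl; first by
  rewrite size_mulX -?size_poly_eq0 IH1.
rewrite size_polyN size_mulX -?size_poly_eq0 IH1 //.
by rewrite mul_polyC; apply: leq_ltn_trans (size_scale_leq _ _) _; rewrite IH0.
Qed.

(** The effect on monomials of sending all indeterminates to 'X. *)
Definition diag_mon (I : choiceType) (R : nzRingType) (m : {cmonom I}) :
    {poly R} :=
  'X^(mdeg m).

Lemma diag_mon_mmorphism I R : mmorphism (@diag_mon I R).
Proof.
by split=> [m1 m2|]; rewrite /diag_mon ?mdegM ?exprD ?mdeg1.
Qed.

HB.instance Definition _ I R :=
  isMultiplicative.Build _ _ (@diag_mon I R) (@diag_mon_mmorphism I R).

(** A continuant in the indeterminates already lies in the polynomial ring, so
    it is nonzero as soon as its image under one ring morphism out of that ring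
    is nonzero; sending all indeterminates to 'X works whatever the constants
    c are. *)
Lemma continuant_ratfun_neq0 (K : fieldType) (c : int -> K) i n :
  continuant (fun j => ratfunC int (c j)) (@ratfunX int K) i n != 0.
Proof.
pose q j : {malg K[{cmonom int}]} := (c j)%:MP.
pose x j : {malg K[{cmonom int}]} := << ucm j >>.
rewrite -[continuant _ _ _ _]/(continuant (@FracField.tofrac _ \o q)
  (@FracField.tofrac _ \o x) i n).
rewrite -rmorph_continuant tofrac_eq0; apply/eqP => D0.
have := congr1 (mmap (@polyC K) (@diag_mon int K)) D0.
rewrite raddf0 (rmorph_continuant _ _ _ q x).
rewrite (eq_continuant _ _ (fun j => (c j)%:P) _ (fun=> 'X)).
- move/(congr1 (fun p : {poly _} => size p)).
  by rewrite size_continuant size_poly0.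
- by move=> j; exact: mmapC.
- by move=> j; rewrite /= mmapU /diag_mon mdegU expr1 mul1r.
Qed.

Section Integrality.
Context (F : fieldType) (q x : int -> F) (i : int) (n : nat).

Lemma in_Zqx1 : in_Zqx q x i n 1.
Proof. by exists 1; rewrite rmorph1. Qed.

Lemma in_ZqxM f g :
  in_Zqx q x i n f -> in_Zqx q x i n g -> in_Zqx q x i n (f * g).
Proof. by move=> [P ->] [Q ->]; exists (P * Q); rewrite rmorphM. Qed.

Lemma in_ZqxB f g :
  in_Zqx q x i n f -> in_Zqx q x i n g -> in_Zqx q x i n (f - g).
Proof. by move=> [P ->] [Q ->]; exists (P - Q); rewrite raddfB. Qed.

Lemma in_Zqx_gen (j : 'I_(n.-1 + n)) : in_Zqx q x i n (Zqx_gens q x i j).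
Proof.
by exists (mpoly.mpolyX _ (mpoly.mnm1 j)); rewrite mpoly.mmapX mpoly.mmap1U.
Qed.

Lemma in_Zqx_q (a : nat) : (a < n.-1)%N -> in_Zqx q x i n (q (i + a.+1%:Z)).
Proof.
move=> lt_an; have := in_Zqx_gen (unsplit (inl (Ordinal lt_an))).
by rewrite /Zqx_gens unsplitK /= -addrA.
Qed.

Lemma in_Zqx_x (b : nat) : (b < n)%N -> in_Zqx q x i n (x (i + b%:Z)).
Proof.
move=> lt_bn; have := in_Zqx_gen (unsplit (inr (Ordinal lt_bn))).
by rewrite /Zqx_gens unsplitK.
Qed.

(** The window i, n of allowed generators stays fixed while the size m of the
    continuant grows up to n, so that the induction never changes the ring. *)
Lemma in_Zqx_continuant m : (m <= n)%N -> in_Zqx q x i n (continuant q x i m).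
Proof.
elim/nat_ind2: m => [_|n_gt0|m IH0 IH1 lt_mn]; first exact: in_Zqx1.
  by rewrite /= -[i in x i]addr0; exact: in_Zqx_x.
rewrite continuantSS; apply: in_ZqxB; apply: in_ZqxM.
- exact: in_Zqx_x.
- by apply: IH1; exact: ltnW.
- by apply: in_Zqx_q; rewrite -ltnS (ltn_predK lt_mn).
- by apply: IH0; do 2!apply: ltnW.
Qed.

End Integrality.

Theorem theorem1 :
  let x := xfam qind xind in
  (forall (i : int) (n : nat), (1 <= n)%N ->
     x (i + 1) n.-1 != 0 /\
     x i n * x (i + 1) n =
       x i n.+1 * x (i + 1) n.-1 + \prod_(1 <= k < n.+1) qind (i + k%:Z)) /\
  (forall (n : nat) (i : int), (1 <= n)%N ->
     x i n = \det (tridiag qind xind i n) /\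
     in_Zqx qind xind i n (x i n)).
Proof.
have D0 i n : continuant qind xind i n != 0 by exact: continuant_ratfun_neq0.
have xE := xfam_continuant Qqx qind xind D0.
split=> [i [//|n] _ | n i _].
  by rewrite !xE; split; [exact: D0 | exact: continuant_exchange].
by rewrite xE det_tridiag; split=> //; exact: in_Zqx_continuant.
Qed.
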